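(* Let $P$ be a finite graded poset with rank function $r_P$ and let $s=\min\{r_P(p): p\in\max(P)\}$. A multidegree $A\subseteq P$ appears in the first linear strand of $\mathcal{F}(P)$ if and only if (1) every element of $A$ has rank at most $s$, and $A_s\subseteq\max(P)$; (2) for all $1\le i\le s$, $A_i$ is nonempty; (3) the induced subposet of $P$ on $B_i\cup A_{i+1}$ is a complete bipartite graph (every element of $B_i$ lies below every element of $A_{i+1}$) for all $1\le i\le s-1$.
   Context: Let $\Bbbk$ be a field. A finite poset $P$ is graded if it has a rank function $r_P:P\to\mathbb{N}$ with $r_P(p)=1$ for every minimal element $p$ and $r_P(q)=r_P(p)+1$ whenever $q$ covers $p$; its rank is $r=\max\{r_P(p): p\in P\}$. $\max(P)$ is the set of maximal elements of $P$, and $P_i$ is the set of elements of rank $i$. The flag ideal $\mathcal{F}(P)\subseteq\Bbbk[x_p: p\in P]$ is generated by all monomials $x_{p_1}\cdots x_{p_n}$ with $p_1<\cdots<p_n$ a maximal chain of $P$. A subset $A\subseteq P$ is identified with the squarefree multidegree of $\prod_{p\in A}x_p$, and $\beta_{j,A}(\mathcal{F}(P))$ is the corresponding multigraded Betti number. The first linear strand of $\mathcal{F}(P)$ is the $s$-linear strand; $A$ appears in it if $\beta_{j,A}(\mathcal{F}(P))\neq0$ for some $j\ge0$ with $|A|=j+s$. For $A\subseteq P$ put $A_i=A\cap P_i$, $B_1=A_1$, $B_r=A_r$, and $B_i=A_i\setminus\max(P)$ for $i=2,\ldots,r-1$. *)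

(* Defs.v *)
From HB Require Import structures.
From mathcomp Require Import all_boot all_order all_algebra.
From mathcomp Require Import mpoly.

Set Implicit Arguments.
Unset Strict Implicit.
Unset Printing Implicit Defensive.

Import Order.TTheory GRing.Theory.
Local Open Scope ring_scope.

Definition is_minimal (disp : Order.disp_t) (P : finPOrderType disp) (p : P) :
    bool :=
  [forall q : P, ~~ (q < p)%O].

Definition max_elements (disp : Order.disp_t) (P : finPOrderType disp) :
    {set P} :=
  [set p : P | [forall q : P, ~~ (p < q)%O]].

Definition is_cover (disp : Order.disp_t) (P : finPOrderType disp) (p q : P) :
    bool :=
  (p < q)%O && [forall z : P, ~~ ((p < z)%O && (z < q)%O)].

Definition is_rank_function (disp : Order.disp_t) (P : finPOrderType disp)
    (r : P -> nat) : Prop :=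
  (forall p : P, is_minimal p -> r p = 1%N) /\
  (forall p q : P, is_cover p q -> r q = (r p + 1)%N).

Definition poset_rank (disp : Order.disp_t) (P : finPOrderType disp)
    (r : P -> nat) : nat :=
  (\max_(p : P) r p)%N.

Definition is_min_max_rank (disp : Order.disp_t) (P : finPOrderType disp)
    (r : P -> nat) (s : nat) : Prop :=
  (exists2 p : P, p \in max_elements P & r p = s) /\
  (forall p : P, p \in max_elements P -> (s <= r p)%N).

Definition is_chain (disp : Order.disp_t) (P : finPOrderType disp)
    (C : {set P}) : bool :=
  [forall p in C, forall q in C, (p >=< q)%O].

Definition is_maximal_chain (disp : Order.disp_t) (P : finPOrderType disp)
    (C : {set P}) : bool :=
  maxset (@is_chain disp P) C.

(* The polynomial ring k[x_p : p in P] is {mpoly k[#|P|]}, with x_p the variable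
   of index [enum_rank p]. *)
Definition poset_var (k : fieldType) (disp : Order.disp_t)
    (P : finPOrderType disp) (p : P) : {mpoly k[#|P|]} :=
  'X_(enum_rank p).

Definition flag_ideal (k : fieldType) (disp : Order.disp_t)
    (P : finPOrderType disp) (f : {mpoly k[#|P|]}) : Prop :=
  exists c : {set P} -> {mpoly k[#|P|]},
    f = \sum_(C : {set P} | is_maximal_chain C)
          c C * \prod_(p in C) poset_var k p.

Definition mdeg_of_set (disp : Order.disp_t) (P : finPOrderType disp)
    (A : {set P}) : 'X_{1..#|P|} :=
  [multinom nat_of_bool (enum_val i \in A) | i < #|P|].

(* A sequence of finite free modules F_j over S = k[x_0, .., x_(n-1)] with bases
   labelled by multidegrees, so that F_j is the direct sum of the modules
   S(- fdeg j i).  An element of F_j is a row vector of coordinates, and the maps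
   F_(j+1) -> F_j and F_0 -> S are multiplications on the right by [fdiff j] and
   [faug]. *)
Record free_sequence (k : fieldType) (n : nat) := FreeSequence {
  frank : nat -> nat;
  fdeg : forall j : nat, 'I_(frank j) -> 'X_{1..n};
  faug : 'cV[{mpoly k[n]}]_(frank 0);
  fdiff : forall j : nat, 'M[{mpoly k[n]}]_(frank j.+1, frank j)
}.

(* The maps preserve multidegrees: a basis element of degree a is sent to a
   vector whose entry along a basis element of degree b is a scalar multiple of
   x^(a - b), and is 0 unless b divides a. *)
Definition multihomogeneous (k : fieldType) (n : nat) (F : free_sequence k n) :
    Prop :=
  (forall (i : 'I_(frank F 0)) (m : 'X_{1..n}),
      m \in msupp (faug F i 0) -> m = fdeg i) /\
  (forall (j : nat) (i : 'I_(frank F j.+1)) (l : 'I_(frank F j))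
      (m : 'X_{1..n}),
      m \in msupp (fdiff F j i l) -> (m + fdeg l)%MM = fdeg i).

(* Exactness of  .. -> F_2 -> F_1 -> F_0 -> I -> 0. *)
Definition resolves (k : fieldType) (n : nat) (F : free_sequence k n)
    (I : {mpoly k[n]} -> Prop) : Prop :=
  [/\ forall f : {mpoly k[n]},
        I f <-> exists v : 'rV_(frank F 0), v *m faug F = f%:M,
      forall v : 'rV_(frank F 0),
        v *m faug F = 0 <-> exists w : 'rV_(frank F 1), w *m fdiff F 0 = v
    & forall (j : nat) (v : 'rV_(frank F j.+1)),
        v *m fdiff F j = 0 <->
        exists w : 'rV_(frank F j.+2), w *m fdiff F j.+1 = v].

(* The image of F_(j+1) lies in (x_0, .., x_(n-1)) F_j for all j. *)
Definition is_minimal_sequence (k : fieldType) (n : nat)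
    (F : free_sequence k n) : Prop :=
  forall (j : nat) (i : 'I_(frank F j.+1)) (l : 'I_(frank F j)),
    (fdiff F j i l)@_0%MM = 0.

Definition minimal_free_resolution (k : fieldType) (n : nat)
    (F : free_sequence k n) (I : {mpoly k[n]} -> Prop) : Prop :=
  [/\ multihomogeneous F, resolves F I & is_minimal_sequence F].

(* When F is the minimal multigraded free resolution of I, unique up to
   isomorphism, this is beta_(j, a)(I). *)
Definition betti (k : fieldType) (n : nat) (F : free_sequence k n) (j : nat)
    (a : 'X_{1..n}) : nat :=
  #|[set i : 'I_(frank F j) | fdeg i == a]|.

Definition appears_in_strand (k : fieldType) (disp : Order.disp_t)
    (P : finPOrderType disp) (F : free_sequence k #|P|) (s : nat)
    (A : {set P}) : Prop :=
  exists2 j : nat, betti F j (mdeg_of_set A) <> 0%N & #|A| = (j + s)%N.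

Definition rank_part (disp : Order.disp_t) (P : finPOrderType disp)
    (r : P -> nat) (A : {set P}) (i : nat) : {set P} :=
  [set p in A | r p == i].

Definition B_part (disp : Order.disp_t) (P : finPOrderType disp)
    (r : P -> nat) (A : {set P}) (i : nat) : {set P} :=
  if (i == 1%N) || (i == poset_rank r) then rank_part r A i
  else rank_part r A i :\: max_elements P.

(* Main.v *)
(* Every generator of the ideal has degree at least s, so F_j is generated in
   degrees at least j + s, and a vector u of F_j of squarefree degree A with
   |A| = j + s is constant. Its boundary is the sum of the x_a u_a, where u_a is
   a constant vector of degree A - a; minimality makes u = 0 as soon as at most
   one u_a is nonzero, and d^2 = 0 gives (u_a)_b = - (u_b)_a.

   If u <> 0, then by induction A - a satisfies the combinatorial conditions
   whenever u_a <> 0, and anticommutation produces two such elements a, b of the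
   same rank, which forces the conditions on A. Conversely, if A satisfies the
   conditions, its subsets meeting every rank 1, .., s form the dual of a join of
   boundaries of simplices; nonzero vectors of degrees A are built by induction
   on j by lifting the sum of the +- x_a u(A - a), with Koszul signs, along d. *)

Require Import Defs.
From HB Require Import structures.
From mathcomp Require Import all_boot all_order all_algebra.
From mathcomp Require Import mpoly.
From mathcomp Require Import zify.

Set Implicit Arguments.
Unset Strict Implicit.
Unset Printing Implicit Defensive.

Import Order.TTheory GRing.Theory.
Local Open Scope ring_scope.

(** * Low-degree coefficients of polynomials *)

Lemma mpoly_linear_form (k : fieldType) (n : nat) (p : {mpoly k[n]}) :
  (forall m, m \in msupp p -> mdeg m = 1%N) ->
  p = \sum_(a < n) (p@_U_(a)) *: 'X_a.
Proof.
move=> lin_p; apply/mpolyP=> m; rewrite raddf_sum /=.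
have [/eqP/mdeg1P[a /eqP->]|m1] := eqVneq (mdeg m) 1%N.
  rewrite (bigD1 a) //= mcoeffZ mcoeffXU eqxx mulr1 big1 ?addr0 // => b ba.
  by rewrite mcoeffZ mcoeffXU (negbTE ba) mulr0.
rewrite memN_msupp_eq0 ?big1 // => [b _|]; last first.
  by apply: contra m1 => /lin_p->.
rewrite mcoeffZ mcoeffX; case: eqP => [E|_]; last by rewrite mulr0.
by rewrite -E mdeg1 eqxx in m1.
Qed.

Lemma mcoeff0M (k : fieldType) (n : nat) (p q : {mpoly k[n]}) :
  (p * q)@_0%MM = p@_0%MM * q@_0%MM.
Proof. exact: (rmorphM (mcoeff 0%MM)). Qed.

(** The coefficient at [U_(a)] is the constant term of the partial derivative, so this is the
    Leibniz rule with one term killed by the vanishing constant term of [q]. *)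
Lemma mcoeffU_mul (k : fieldType) (n : nat) (p q : {mpoly k[n]}) (a : 'I_n) :
  q@_0%MM = 0 -> (p * q)@_U_(a) = p@_0%MM * q@_U_(a).
Proof.
move=> q0; have D (f : {mpoly k[n]}) : f@_U_(a) = (f^`M(a))@_0%MM.
  by rewrite mcoeff_mderiv add0m mnm0E mulr1n.
by rewrite !D mderivM mcoeffD !mcoeff0M q0 mulr0 add0r.
Qed.

(** Serves to read off the coefficient of x_a x_b in a double sum: only the two orders of the pair
    contribute. *)
Lemma sum_pick_swap (R : nzRingType) (T : finType) (g : T -> T -> R) (a b : T) :
  a != b ->
  \sum_c \sum_d g c d * ((c == a) && (d == b) || (c == b) && (d == a))%:R
  = g a b + g b a.
Proof.
move=> ab; have ba := ab; rewrite eq_sym in ba.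
rewrite (bigD1 a) //= [X in _ + X](bigD1 b) //= [X in _ + (_ + X)]big1 ?addr0; last first.
  move=> c /andP[ca cb]; rewrite big1 // => d _.
  by rewrite (negbTE ca) (negbTE cb) mulr0.
congr (_ + _).
  rewrite (bigD1 b) //= big1 ?addr0 ?eqxx ?mulr1 // => d db.
  by rewrite (negbTE ab) (negbTE db) mulr0.
rewrite (bigD1 a) //= big1 ?addr0 ?eqxx ?(negbTE ba) ?mulr1 // => d da.
by rewrite (negbTE da) mulr0.
Qed.

(** * Constant vectors in the lowest linear strand of a minimal resolution *)

Section LinearStrand.

Variables (k : fieldType) (n : nat) (F : free_sequence k n).
Variables (I : {mpoly k[n]} -> Prop) (s : nat).
Hypothesis resF : minimal_free_resolution F I.
Hypothesis I_ge : forall f m, I f -> m \in msupp f -> (s <= mdeg m)%N.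

Definition const_row j (u : 'rV[k]_(frank F j)) : 'rV[{mpoly k[n]}]_(frank F j) :=
  map_mx (@mpolyC n k) u.

(** Merges the augmentation (j = 0) with the differentials, so that exactness reads the same in
    every homological degree. *)
Definition bdry_zero j : 'rV[{mpoly k[n]}]_(frank F j) -> Prop :=
  match j with
  | 0 => fun v => v *m faug F = 0
  | j'.+1 => fun v => v *m fdiff F j' = 0
  end.

Lemma bdry_zeroP j (v : 'rV_(frank F j)) :
  bdry_zero v <-> exists w, w *m fdiff F j = v.
Proof. by case: resF => _ [_ ? ?] _; case: j v. Qed.

Lemma bdry_zeroZ j (c : {mpoly k[n]}) (v : 'rV_(frank F j)) :
  c != 0 -> bdry_zero (c *: v) -> bdry_zero v.
Proof.
move=> c0; case: j v => [|j] v /=; rewrite -scalemxAl => /matrixP E;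
  by apply/matrixP=> i l; move/eqP: (E i l); rewrite !mxE mulf_eq0 (negbTE c0) => /eqP.
Qed.

(** By exactness the row is a boundary, and by minimality the entries of a boundary have no constant
    term. *)
Lemma const_row_cycle_eq0 j (u : 'rV[k]_(frank F j)) :
  bdry_zero (const_row u) -> u = 0.
Proof.
case: resF => _ _ minF; case/bdry_zeroP => w /rowP E; apply/rowP=> l.
have := congr1 (mcoeff 0%MM) (E l); rewrite !mxE mcoeffC eqxx mulr1 => <-.
by rewrite raddf_sum big1 // => i _ /=; rewrite mcoeff0M minF mulr0.
Qed.

Lemma delta_row_neq0 j (l : 'I_(frank F j)) :
  delta_mx (0 : 'I_1) l != 0 :> 'rV[k]_(frank F j).
Proof. by apply/eqP => /rowP/(_ l)/eqP; rewrite !mxE !eqxx oner_eq0. Qed.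

Lemma const_row_delta j (l : 'I_(frank F j)) :
  const_row (delta_mx 0 l) = delta_mx 0 l.
Proof.
by apply/rowP => h; rewrite !mxE; case: (_ && _); rewrite ?mpolyC1 ?mpolyC0.
Qed.

Lemma msupp_neq0 (p : {mpoly k[n]}) : p != 0 -> exists m, m \in msupp p.
Proof. by exists (mlead p); apply: mlead_supp. Qed.

(** A zero entry of [faug] would make a basis vector a constant cycle. *)
Lemma faug_monomial (i : 'I_(frank F 0)) :
  I (faug F i 0) /\ fdeg i \in msupp (faug F i 0).
Proof.
have [[hom0 _] [img _ _] _] := resF; split.
  apply/img; exists (delta_mx 0 i); rewrite -rowE.
  by apply/matrixP => a b; rewrite !mxE !ord1 eqxx mulr1n.
have [E|/msupp_neq0[m mi]] := eqVneq (faug F i 0) 0; last by rewrite -(hom0 _ _ mi).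
case/eqP: (delta_row_neq0 i); apply: const_row_cycle_eq0 => /=.
by rewrite const_row_delta -rowE; apply/matrixP => a b; rewrite !mxE !ord1.
Qed.

(** No row of a differential vanishes, since a basis vector is not a cycle; by minimality the
    monomials of a nonzero entry have positive degree, so each homological step raises the degree by
    at least one. *)
Lemma fdeg_ge j (i : 'I_(frank F j)) : (j + s <= mdeg (fdeg i))%N.
Proof.
have [[_ homS] _ minF] := resF.
elim: j i => [|j IHj] i; first by have [/I_ge] := faug_monomial i; apply.
have [l [m mi]] : exists l m, m \in msupp (fdiff F j i l).
  have [/eqP E|/rV0Pn[l]] := boolP (row i (fdiff F j) == 0).
    case/eqP: (delta_row_neq0 i); apply: const_row_cycle_eq0 => /=.
    by rewrite const_row_delta -rowE.
  by rewrite mxE => /msupp_neq0[m mi]; exists l, m.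
have m0 : mdeg m != 0%N.
  rewrite mdeg_eq0; apply: contraTneq mi => ->.
  by rewrite mcoeff_msupp minF eqxx.
rewrite -(homS _ _ _ _ mi) mdegD; have := IHj l; lia.
Qed.

(** These vectors form a space of dimension [betti F j B], so a nonzero Betti number becomes the
    existence of a nonzero vector. *)
Definition strand j (B : 'X_{1..n}) (u : 'rV[k]_(frank F j)) : Prop :=
  forall l, u 0 l != 0 -> fdeg l = B.

(** On the linear strand these scalar matrices determine the differential, and those of distinct
    variables anticommute. *)
Definition xpart j (a : 'I_n) : 'M[k]_(frank F j.+1, frank F j) :=
  map_mx (mcoeff U_(a)%MM) (fdiff F j).

(** Minimality excludes constant terms, and the target degree is at least j + s, which leaves only
    monomials of degree one. *)
Lemma fdiff_linear j (i : 'I_(frank F j.+1)) (l : 'I_(frank F j)) :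
  mdeg (fdeg i) = (j.+1 + s)%N ->
  fdiff F j i l = \sum_a (fdiff F j i l)@_U_(a) *: 'X_a.
Proof.
have [[_ homS] _ minF] := resF => Ei; apply: mpoly_linear_form => m mi.
have m0 : mdeg m != 0%N.
  rewrite mdeg_eq0; apply: contraTneq mi => ->.
  by rewrite mcoeff_msupp minF eqxx.
have := congr1 mdeg (homS _ _ _ _ mi); rewrite mdegD Ei.
have := fdeg_ge l; lia.
Qed.

Lemma strand_bdry j B (u : 'rV[k]_(frank F j.+1)) :
  strand B u -> mdeg B = (j.+1 + s)%N ->
  const_row u *m fdiff F j = \sum_a 'X_a *: const_row (u *m xpart j a).
Proof.
move=> uB dB; apply/rowP => l; rewrite summxE !mxE.
under [RHS]eq_bigr => a _ do
  rewrite !mxE raddf_sum mulr_sumr.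
rewrite exchange_big /=; apply: eq_bigr => i _; rewrite !mxE.
have [->|/uB Ei] := eqVneq (u 0 i) 0.
  by rewrite mpolyC0 mul0r big1 // => a _; rewrite mul0r mpolyC0 mulr0.
rewrite [fdiff F j i l in LHS]fdiff_linear ?Ei // mulr_sumr.
apply: eq_bigr => a _; rewrite !mxE mpolyCM mulrCA -mul_mpolyC.
by rewrite [_%:MP * 'X_a]mulrC.
Qed.

Lemma strand_xpart j B (u : 'rV[k]_(frank F j.+1)) a :
  strand B u -> forall l, (u *m xpart j a) 0 l != 0 -> (U_(a) + fdeg l)%MM = B.
Proof.
have [[_ homS] _ minF] := resF => uB l; apply: contraNeq => ne.
rewrite !mxE big1 // => i _; rewrite !mxE.
have [->|/uB Ei] := eqVneq (u 0 i) 0; first by rewrite mul0r.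
rewrite memN_msupp_eq0 ?mulr0 //; apply: contra ne => /homS.
by rewrite Ei => ->.
Qed.

(** The boundary of [u] is x_c times a constant row; cancelling x_c leaves a constant cycle, which
    is zero, and then [u] itself is a constant cycle. *)
Lemma xpart_eq0 j B (u : 'rV[k]_(frank F j.+1)) (c : 'I_n) :
  strand B u -> mdeg B = (j.+1 + s)%N ->
  (forall a, a != c -> u *m xpart j a = 0) -> u = 0.
Proof.
move=> uB dB H.
suff cE : u *m xpart j c = 0.
  apply: const_row_cycle_eq0 => /=; rewrite (strand_bdry uB dB) big1 // => a _.
  have -> : u *m xpart j a = 0 by have [->|/H] := eqVneq a c.
  by rewrite /const_row map_mx0 scaler0.
apply: const_row_cycle_eq0; apply: (@bdry_zeroZ _ 'X_c).
  by apply/eqP => /(congr1 (mcoeff U_(c)%MM))/eqP; rewrite mcoeffX eqxx mcoeff0 oner_eq0.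
apply/bdry_zeroP; exists (const_row u); rewrite (strand_bdry uB dB).
rewrite (bigD1 c) //= big1 ?addr0 // => a /H->.
by rewrite /const_row map_mx0 scaler0.
Qed.

Lemma xpart_anticomm j B (u : 'rV[k]_(frank F j.+2)) (a b : 'I_n) :
  strand B u -> mdeg B = (j.+2 + s)%N -> a != b ->
  u *m xpart j.+1 a *m xpart j b = - (u *m xpart j.+1 b *m xpart j a).
Proof.
move=> uB dB ab; apply/rowP => l.
have dd : const_row u *m fdiff F j.+1 *m fdiff F j = 0.
  have [_ [_ _ ex] _] := resF.
  by apply/ex; exists (const_row u).
have step c : const_row (u *m xpart j.+1 c) *m fdiff F j
    = \sum_e 'X_e *: const_row (u *m xpart j.+1 c *m xpart j e).
  (* A nonzero coordinate [l0] supplies the degree of the part as [fdeg l0], which avoids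
     subtracting multidegrees. *)
  have [-> | /rV0Pn [l0 /(strand_xpart uB) E]] := eqVneq (u *m xpart j.+1 c) 0.
    rewrite /const_row map_mx0 mul0mx big1 // => e _.
    by rewrite mul0mx map_mx0 scaler0.
  apply: (@strand_bdry _ (fdeg l0)) => [h /(strand_xpart uB)|].
    by rewrite -E => /addmI.
  by have := congr1 mdeg E; rewrite mdegD mdeg1 dB; lia.
have coef c d : ('X_c * 'X_d : {mpoly k[n]})@_(U_(a) + U_(b))
    = ((c == a) && (d == b) || (c == b) && (d == a))%:R.
  rewrite -mpolyXD mcoeffX; congr (nat_of_bool _)%:R.
  apply/eqP/idP => [/mnmP E|/orP[]/andP[/eqP-> /eqP->] //]; last by rewrite addmC.
  have : ~~ ((c == a) && (c == b)).
    by apply: contra ab => /andP[/eqP<- /eqP<-].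
  have := E b; have := E a; have := E c; rewrite !mnmDE !mnm1E !eqxx.
  rewrite !(eq_sym a c) !(eq_sym b c) (eq_sym b a) (negbTE ab).
  by case: (c == a); case: (c == b); case: (d == c); case: (d == a); case: (d == b).
have := congr1 (fun v : 'rV_(frank F j) => (v 0 l)@_(U_(a) + U_(b))) dd.
rewrite (strand_bdry uB dB) mulmx_suml.
under eq_bigr => c _ do rewrite -scalemxAl step scaler_sumr.
rewrite summxE raddf_sum mxE mcoeff0 /=.
under eq_bigr => c _ do
  (rewrite summxE raddf_sum; under eq_bigr => d _ do
     rewrite 2!mxE mulrA !mxE mulrC /= mcoeffCM coef).
rewrite sum_pick_swap // => /eqP; rewrite addr_eq0 => /eqP E.
by rewrite [LHS]mxE E !mxE.
Qed.

Lemma xpart_lift j B (w : 'I_n -> 'rV[k]_(frank F j)) :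
  (forall a l, w a 0 l != 0 -> (U_(a) + fdeg l)%MM = B) ->
  bdry_zero (\sum_a 'X_a *: const_row (w a)) ->
  exists2 u : 'rV[k]_(frank F j.+1), strand B u & forall a, u *m xpart j a = w a.
Proof.
have [[_ homS] _ minF] := resF => wB /bdry_zeroP [W /rowP WE].
(* Any preimage [W] will do: in degree B, only its constant terms along basis elements of degree B
   contribute to the x_a-coefficients. *)
exists (\row_i if fdeg i == B then (W 0 i)@_0%MM else 0) => [i|a].
  by rewrite mxE; case: (fdeg i =P B) => // _; rewrite eqxx.
apply/rowP => l; have := congr1 (mcoeff U_(a)%MM) (WE l).
rewrite summxE !mxE !raddf_sum /= (bigD1 a) //= !mxE [X in _ = _ + X]big1 => [|b ba].
  rewrite mulrC mcoeffCM mcoeffXU eqxx mulr1 addr0.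
  have [lB|lB] := eqVneq (U_(a) + fdeg l)%MM B; last first.
    move=> _; have -> : w a 0 l = 0 by apply/eqP; apply: contraNT lB => /wB->.
    rewrite big1 // => i _; rewrite !mxE; case: eqP => [Ei|_]; last by rewrite mul0r.
    rewrite [X in _ * X]memN_msupp_eq0 ?mulr0 //; apply: contra lB => /homS.
    by rewrite Ei => ->.
  move=> <-; apply: eq_bigr => i _; rewrite !mxE mcoeffU_mul ?minF //.
  case: eqP => // Ei; rewrite mul0r [X in _ * X]memN_msupp_eq0 ?mulr0 //.
  by apply: contra_notN Ei => /homS <-.
by rewrite !mxE mulrC mcoeffCM mcoeffXU (negbTE ba) mulr0.
Qed.

(** Generators have degree at least s = |B|, so in a combination equal to x^B only constant
    coefficients along generators of degree exactly B contribute. *)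
Lemma generator_lift (B : 'X_{1..n}) :
  mdeg B = s -> I 'X_[B] ->
  exists2 u : 'rV[k]_(frank F 0), strand B u & const_row u *m faug F = ('X_[B])%:M.
Proof.
have [[hom0 _] [img _ _] _] := resF => dB /img [W WE].
exists (\row_i if fdeg i == B then (W 0 i)@_0%MM else 0) => [i|].
  by rewrite mxE; case: (fdeg i =P B) => // _; rewrite eqxx.
apply/matrixP => h l; rewrite !ord1 {h l} [RHS]mxE eqxx mulr1n.
apply/mpolyP => m; rewrite mxE raddf_sum mcoeffX /=.
under eq_bigr => i _ do rewrite !mxE mcoeffCM.
have [<-|Bm] := eqVneq B m; last first.
  rewrite big1 // => i _; case: (fdeg i =P B) => [Ei|_]; last by rewrite mul0r.
  rewrite [X in _ * X]memN_msupp_eq0 ?mulr0 //; apply: contra Bm => /hom0.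
  by rewrite Ei => ->.
have := congr1 (fun M : 'M_1 => (M 0 0)@_B) WE.
rewrite [in RHS]mxE eqxx mulr1n mcoeffX eqxx mxE raddf_sum /= => <-.
apply: eq_bigr => i _.
have faugE : faug F i 0 = (faug F i 0)@_(fdeg i) *: 'X_[fdeg i].
  apply/mpolyP => p; rewrite mcoeffZ mcoeffX.
  have [->|np] := eqVneq (fdeg i) p; first by rewrite mulr1.
  by rewrite mulr0 memN_msupp_eq0 //; apply: contra np => /hom0->.
rewrite [faug F i 0 in RHS]faugE -scalerAr mcoeffZ [RHS]mulrC.
case: (fdeg i =P B) => [->|Ei].
  by congr (_ * _); rewrite -[X in _ = mcoeff X _]addm0 mcoeffMX.
rewrite mul0r [X in _ = X * _]memN_msupp_eq0 ?mul0r //.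
apply/negP; rewrite (perm_mem (msuppMX _ _)) => /mapP[p _ E]; apply: Ei.
have := congr1 mdeg E; have := fdeg_ge i; rewrite mdegD dB => h e.
have /eqP : mdeg p = 0%N by lia.
by rewrite mdeg_eq0 E => /eqP->; rewrite addm0.
Qed.

End LinearStrand.

(** * Ranks, twins and maximal chains in a graded poset *)

Section RankedPoset.

Variables (disp : Order.disp_t) (P : finPOrderType disp) (r : P -> nat) (s : nat).
Hypothesis r_rank : is_rank_function r.
Hypothesis s_min : is_min_max_rank r s.

Lemma cover_between (p q : P) :
  (p < q)%O -> exists2 z, is_cover p z & (z <= q)%O.
Proof.
have [m] := ubnP #|[set z | (p < z < q)%O]|; elim: m q => // m IHm q lt_m pq.
have [c|] := boolP (is_cover p q); first by exists q.
rewrite /is_cover pq /= negb_forall => /existsP[z]; rewrite negbK => /andP[pz zq].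
have [|//|w pw wz] := IHm z; last by exists w => //; apply: le_trans wz (ltW zq).
apply: leq_trans (proper_card _) (lt_m : (_ <= m)%N); apply/properP; split.
  by apply/subsetP=> x; rewrite !inE => /andP[-> /lt_trans->].
by exists z; rewrite !inE ?pz ?zq // ltxx andbF.
Qed.

Lemma rank_lt (p q : P) : (p < q)%O -> (r p < r q)%N.
Proof.
have [m] := ubnP #|[set z | (p < z)%O]|; elim: m p => // m IHm p lt_m pq.
have [z pz zq] := cover_between pq.
have [_ /(_ _ _ pz) Ez] := r_rank.
have [pz' _] := andP pz.
move: zq; rewrite le_eqVlt => /predU1P[<-|zq]; first by rewrite Ez addn1.
apply: leq_trans (IHm z _ zq); first by rewrite Ez addn1 ltnW.
apply: leq_trans (proper_card _) (lt_m : (_ <= m)%N); apply/properP; split.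
  by apply/subsetP=> x; rewrite !inE; apply: lt_trans.
by exists z; rewrite !inE ?ltxx.
Qed.

Lemma rank_gt0 (p : P) : (0 < r p)%N.
Proof.
have [|] := boolP (is_minimal p); first by case: r_rank => H _ /H->.
rewrite negb_forall => /existsP[z]; rewrite negbK => zp.
by apply: leq_trans (rank_lt zp).
Qed.

Lemma max_rank_ge (p : P) : p \in max_elements P -> (s <= r p)%N.
Proof. by case: s_min => _; apply. Qed.

Lemma s_gt0 : (0 < s)%N.
Proof. by case: s_min => -[p _ <-] _; apply: rank_gt0. Qed.

Definition hits_ranks (A : {set P}) : Prop :=
  forall i, (1 <= i <= s)%N -> exists2 p, p \in A & r p = i.

(* Removing one of two twins from A keeps an element of every rank. *)
Definition twins (A : {set P}) (p q : P) : Prop :=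
  [/\ p \in A, q \in A, p != q & r p = r q].

(** The conditions of the theorem with A_i in place of B_i; the two forms agree because an element
    of rank below s is never maximal. *)
Definition complete_ranked (A : {set P}) : Prop :=
  [/\ forall p, p \in A -> (r p <= s)%N,
      forall p, p \in A -> r p = s -> p \in max_elements P,
      hits_ranks A
    & forall p q, p \in A -> q \in A -> r q = (r p).+1 -> (p < q)%O].

Lemma twinsC (A : {set P}) p q : twins A p q -> twins A q p.
Proof. by case=> pA qA pq E; split; rewrite 1?eq_sym. Qed.

Lemma twinsD1 (A : {set P}) p q z : twins A p q -> p != z -> q != z -> twins (A :\ z) p q.
Proof. by case=> pA qA pq E pz qz; split; rewrite ?inE ?pz ?qz. Qed.

Lemma twins_sub (A : {set P}) p q z : twins (A :\ z) p q -> twins A p q.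
Proof. by case; rewrite !inE => /andP[_ ?] /andP[_ ?] ? ?; split. Qed.

Lemma hits_ranks_sub (A A' : {set P}) : A \subset A' -> hits_ranks A -> hits_ranks A'.
Proof. by move=> /subsetP sA H i /H[p /sA]; exists p. Qed.

Lemma hits_ranksD1 (A : {set P}) p q : twins A p q -> hits_ranks A -> hits_ranks (A :\ p).
Proof.
move=> [pA qA pq Epq] H i /H[z zA <-].
have [->|zp] := eqVneq z p; first by exists q; rewrite // !inE eq_sym pq.
by exists z; rewrite // !inE zp.
Qed.

Lemma hits_ranks_twin (A : {set P}) p : hits_ranks (A :\ p) -> p \in A -> (r p <= s)%N ->
  exists q, twins A p q.
Proof.
move=> H pA ps; have [|q] := H (r p); first by rewrite rank_gt0.
by rewrite !inE => /andP[qp qA] E; exists q; split; rewrite 1?eq_sym.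
Qed.

Lemma complete_rankedD1 (A : {set P}) p q :
  twins A p q -> complete_ranked A -> complete_ranked (A :\ p).
Proof.
move=> tpq [le_s maxs hits lts]; split; last 2 first.
- exact: hits_ranksD1 tpq hits.
- by move=> x y; rewrite !in_setD1 => /andP[_ xA] /andP[_ yA]; apply: lts.
- by move=> x; rewrite !in_setD1 => /andP[_ /le_s].
- by move=> x; rewrite !in_setD1 => /andP[_ /maxs].
Qed.

(** Since b and c have equal rank, two elements of consecutive ranks never include both, so each
    order relation is already visible in one of the two smaller sets. *)
Lemma complete_ranked_glue (A : {set P}) b c : twins A b c ->
  complete_ranked (A :\ b) -> complete_ranked (A :\ c) -> complete_ranked A.
Proof.
move=> [bA cA bc Ebc] [le_b max_b hit_b lt_b] [le_c max_c hit_c lt_c].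
have in_b x : x \in A -> x != b -> x \in A :\ b by rewrite !inE => -> ->.
have in_c x : x \in A -> x != c -> x \in A :\ c by rewrite !inE => -> ->.
have cb := bc; rewrite eq_sym in cb.
split.
- move=> x xA; have [->|/in_b/le_b] := eqVneq x b; last by auto.
  exact/le_c/in_c.
- move=> x xA; have [->|/in_b/max_b] := eqVneq x b; last by auto.
  exact/max_c/in_c.
- exact: hits_ranks_sub (subsetDl _ _) hit_b.
move=> x y xA yA Exy.
have [Ex|xb] := eqVneq x b; last have [Ey|yb] := eqVneq y b.
- subst x; apply: lt_c; rewrite ?in_c //.
  by apply/eqP => Ey; move: Exy; rewrite Ey Ebc; lia.
- subst y; apply: lt_c; rewrite ?in_c //.
  by apply/eqP => Ex; move: Exy; rewrite Ex Ebc; lia.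
- by apply: lt_b; rewrite ?in_b.
Qed.

Lemma hits_ranks_card (A : {set P}) : hits_ranks A -> (s <= #|A|)%N.
Proof.
move=> H; rewrite -[s](size_iota 1) cardE -(size_map r).
apply: uniq_leq_size (iota_uniq _ _) _ => i; rewrite mem_iota => iP.
have [|p pA <-] := H i; first by lia.
by apply/map_f; rewrite mem_enum.
Qed.

Lemma hits_ranks_twins_card (A : {set P}) p q : twins A p q -> hits_ranks A -> (s < #|A|)%N.
Proof.
move=> t /(hits_ranksD1 t)/hits_ranks_card; case: t => pA _ _ _.
by rewrite [X in (_ < X)%N](cardsD1 p) pA.
Qed.

(** Pigeonhole: the ranks lie in 1, .., s. *)
Lemma twins_exist (A : {set P}) :
  (forall p, p \in A -> (r p <= s)%N) -> (s < #|A|)%N -> exists p q, twins A p q.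
Proof.
move=> le_s; case: (boolP [exists p, exists q, [&& p \in A, q \in A, p != q & r p == r q]]).
  case/existsP=> p /existsP[q] /and4P[pA qA pq /eqP E] _; by exists p, q; split.
move=> H; rewrite ltnNge; case/negP.
rewrite cardE -(size_map r) -[s in leqRHS](size_iota 1); apply: uniq_leq_size.
  rewrite map_inj_in_uniq ?enum_uniq // => p q; rewrite !mem_enum => pA qA E.
  apply/eqP; apply: contraNT H => pq; apply/existsP; exists p; apply/existsP; exists q.
  by rewrite pA qA pq E eqxx.
move=> i /mapP[p]; rewrite mem_enum => /le_s ps ->.
by rewrite mem_iota; have := rank_gt0 p; lia.
Qed.

(** An element of A in each intermediate rank links p to q through consecutive ranks. *)
Lemma complete_ranked_lt (A : {set P}) p q : complete_ranked A -> p \in A -> q \in A ->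
  (r p < r q)%N -> (p < q)%O.
Proof.
move=> [le_s _ hits lts] pA.
suff H m z : z \in A -> r z = m -> (r p < m)%N -> (p < z)%O by move=> qA; apply: H.
elim: m z => // m IHm z zA Ez.
rewrite ltnS leq_eqVlt => /predU1P[E|lt_m]; first by apply: lts; rewrite // Ez E.
have := le_s z zA; rewrite Ez => ms.
have [|w wA Ew] := hits m; first by lia.
by apply: lt_trans (IHm w wA Ew _) (lts _ _ wA zA _); rewrite ?Ez ?Ew.
Qed.

Lemma is_chainP (C : {set P}) :
  reflect {in C &, forall p q, (p >=< q)%O} (is_chain C).
Proof.
apply: (iffP forall_inP) => H p; last first.
  by move=> pC; apply/forall_inP => q; apply: H.
by move=> q pC qC; apply: (forall_inP (H p pC)).
Qed.

Lemma complete_ranked_maximal_chain (A : {set P}) :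
  complete_ranked A -> #|A| = s -> is_maximal_chain A.
Proof.
move=> cA cardA; have [le_s maxs hits _] := cA.
have inj_r p q : p \in A -> q \in A -> r p = r q -> p = q.
  move=> pA qA E; apply/eqP; apply: contraT => pq.
  by have := hits_ranks_twins_card (And4 pA qA pq E) hits; rewrite cardA ltnn.
apply/maxsetP; split.
  apply/is_chainP=> p q pA qA; case: (ltngtP (r p) (r q)) => [||E].
  - by move=> /(complete_ranked_lt cA pA qA)/lt_comparable.
  - by move=> /(complete_ranked_lt cA qA pA)/gt_comparable.
  - by rewrite (inj_r p q) ?comparablexx.
(* An element z of a larger chain either shares its rank with some t in A, and then equals it, or
   has rank above s and would lie above the maximal element of A of rank s. *)
move=> C /is_chainP chC sAC; apply/eqP; rewrite eqEsubset sAC andbT.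
apply/subsetP=> z zC.
have [zs|sz] := leqP (r z) s.
  have [|t tA Et] := hits (r z); first by rewrite rank_gt0.
  have [<- //|tz] := eqVneq t z.
  have tC := subsetP sAC _ tA.
  case: (comparable_ltgtP (chC _ _ tC zC)) => [/rank_lt|/rank_lt|E].
  - by rewrite Et ltnn.
  - by rewrite Et ltnn.
  - by rewrite E eqxx in tz.
have [|t tA Et] := hits s; first by rewrite s_gt0 leqnn.
have := maxs _ tA Et; rewrite inE => /forallP/(_ z) tz.
have tC := subsetP sAC _ tA.
case: (comparable_ltgtP (chC _ _ tC zC)) => [E|/rank_lt|E].
- by rewrite E in tz.
- by rewrite Et; lia.
- by rewrite -E.
Qed.

Lemma maximal_chain_mem (C : {set P}) z : is_maximal_chain C ->
  (forall x, x \in C -> (x >=< z)%O) -> z \in C.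
Proof.
case/maxsetP => /is_chainP chC maxC cz.
rewrite -(maxC (z |: C)) ?setU11 ?subsetUr //.
apply/is_chainP => x y; rewrite !inE => /predU1P[->|xC] /predU1P[->|yC] //.
- exact: comparablexx.
- by rewrite comparable_sym cz.
- exact: cz.
- exact: chC.
Qed.

(** Take q in C below p of largest rank: a cover z of q strictly below p would be comparable with
    all of C, hence in C, against the choice of q. If C had nothing below p, any z below p could be
    added. *)
Lemma maximal_chain_pred (C : {set P}) p : is_maximal_chain C -> p \in C ->
  (1 < r p)%N -> exists2 q, q \in C & r p = (r q).+1.
Proof.
move=> mC pC p1; have /maxsetP[/is_chainP chC _] := mC.
case: (pickP [pred q | (q \in C) && (q < p)%O]) => [q0 q0P|below].
  case: (arg_maxnP r q0P) => q /andP[qC qp] qmax.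
  have [z qz] := cover_between qp; have [qz' _] := andP qz.
  rewrite le_eqVlt => /predU1P[<-|zp].
    by exists q; rewrite // -addn1; apply: (proj2 r_rank).
  have zC : z \in C.
    apply: maximal_chain_mem mC _ => x xC.
    have [/orP[xq|qx] /orP[xp|px]] := (chC _ _ xC qC, chC _ _ xC pC).
    - exact/le_comparable/ltW/(le_lt_trans xq).
    - exact/le_comparable/ltW/(le_lt_trans xq).
    - move: xp; rewrite le_eqVlt => /predU1P[->|xp]; first exact/gt_comparable.
      move: qx; rewrite le_eqVlt => /predU1P[<-|qx]; first exact/lt_comparable.
      by have := qmax x; rewrite /= xC xp leqNgt (rank_lt qx) => /(_ isT).
    - exact/gt_comparable/(lt_le_trans zp).
  by have := qmax z; rewrite /= zC zp leqNgt (rank_lt qz') => /(_ isT).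
have [/(proj1 r_rank) E|] := boolP (is_minimal p); first by rewrite E in p1.
rewrite negb_forall => /existsP[z]; rewrite negbK => zp.
have zC : z \in C.
  apply: maximal_chain_mem mC _ => x xC; have := below x; rewrite /= xC /= => xp.
  have := chC _ _ xC pC; rewrite /Order.comparable le_eqVlt xp orbF.
  case/orP=> [/eqP->|px]; first exact/gt_comparable.
  exact/gt_comparable/(lt_le_trans zp).
by have := below z; rewrite /= zC zp.
Qed.

Lemma maximal_chain_top (C : {set P}) : is_maximal_chain C ->
  exists2 p, p \in C & p \in max_elements P.
Proof.
move=> mC; have /maxsetP[/is_chainP chC _] := mC.
have [p0 p0C] : exists p0, p0 \in C.
  (* The empty chain is not maximal, because P has an element, namely one realising s. *)
  have [C0|//] := set_0Vmem C; last by case=> p; exists p.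
  have [[p _ _] _] := s_min; exists p; apply: maximal_chain_mem mC _ => x.
  by rewrite C0 inE.
case: (arg_maxnP r p0C) => t tC tmax; exists t; first by [].
rewrite inE; apply/forallP => z; apply/negP => tz.
have zC : z \in C.
  apply: maximal_chain_mem mC _ => x xC.
  have /orP[xt|] := chC _ _ xC tC; first exact/lt_comparable/(le_lt_trans xt).
  rewrite le_eqVlt => /predU1P[<-|/rank_lt tx]; first exact/lt_comparable.
  by have := tmax x xC; rewrite /= leqNgt tx.
by have := tmax z zC; rewrite /= leqNgt (rank_lt tz).
Qed.

Lemma maximal_chain_hits (C : {set P}) : is_maximal_chain C -> hits_ranks C.
Proof.
move=> mC; have [t tC /max_rank_ge ts] := maximal_chain_top mC.
move=> i /andP[i1 is'].
suff H m p : p \in C -> r p = m -> (i <= m)%N -> exists2 q, q \in C & r q = i.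
  by apply: (H _ t tC erefl); apply: leq_trans ts.
elim: m p => [|m IHm] p pC Ep; first by lia.
rewrite leq_eqVlt => /predU1P[->|im]; first by exists p.
have [|q qC E] := maximal_chain_pred mC pC; first by lia.
by apply: (IHm q) => //; lia.
Qed.

(** With only s elements, C loses some rank 1, .., s when any element is removed; an element of rank
    above s could be removed for free, and so could a top element strictly above rank s. *)
Lemma maximal_chain_complete (C : {set P}) :
  is_maximal_chain C -> #|C| = s -> complete_ranked C.
Proof.
move=> mC cardC; have hits := maximal_chain_hits mC.
have /maxsetP[/is_chainP chC _] := mC.
split=> //.
- move=> p pC; rewrite leqNgt; apply/negP => sp.
  have : hits_ranks (C :\ p).
    move=> i iP; have [q qC Eq] := hits i iP; exists q; rewrite // !inE qC andbT.
    by apply/eqP => E; move: Eq; rewrite E; lia.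
  by move/hits_ranks_card; rewrite -cardC (cardsD1 p C) pC ltnn.
- move=> p pC Ep; have [t tC tmax] := maximal_chain_top mC.
  have ts := max_rank_ge tmax.
  have [<- //|tp] := eqVneq t p.
  have pt : (r p < r t)%N.
    move: tmax; rewrite inE => /forallP/(_ p) tmax; apply: rank_lt.
    case: (comparable_ltgtP (chC _ _ tC pC)) => // E; first by rewrite E in tmax.
    by rewrite E eqxx in tp.
  have : hits_ranks (C :\ t).
    move=> i iP; have [q qC Eq] := hits i iP; exists q; rewrite // !inE qC andbT.
    by apply/eqP => E; move: Eq; rewrite E; lia.
  by move/hits_ranks_card; rewrite -cardC (cardsD1 t C) tC ltnn.
move=> p q pC qC E; case: (comparable_ltgtP (chC _ _ pC qC)) => // [/rank_lt|Epq].
  by lia.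
by move: E; rewrite Epq; lia.
Qed.

End RankedPoset.

(** * Squarefree multidegrees and monomials of the flag ideal *)

Section SquarefreeDegrees.

Variables (k : fieldType) (disp : Order.disp_t) (P : finPOrderType disp).
Implicit Types (A C : {set P}) (p : P).

Lemma mdeg_mdeg_of_set A : mdeg (mdeg_of_set A) = #|A|.
Proof.
rewrite mdegE (reindex _ (onW_bij _ (@enum_rank_bij P))) /= -[RHS]sum1_card [RHS]big_mkcond /=.
by apply: eq_bigr => p _; rewrite mnmE enum_rankK; case: (p \in A).
Qed.

Lemma mdeg_of_set_le A C m : (mdeg_of_set C + m = mdeg_of_set A)%MM -> C \subset A.
Proof.
move=> E; apply/subsetP => p pC; have /mnmP/(_ (enum_rank p)) := E.
by rewrite mnmDE !mnmE enum_rankK pC; case: (p \in A).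
Qed.

Lemma mdeg_of_setD1 A p : p \in A ->
  (U_(enum_rank p) + mdeg_of_set (A :\ p))%MM = mdeg_of_set A.
Proof.
move=> pA; apply/mnmP => a; rewrite mnmDE mnm1E !mnmE !inE.
rewrite -(inj_eq enum_val_inj) enum_rankK eq_sym.
by case: eqP => [->|] //=; rewrite pA.
Qed.

Lemma mdeg_of_set_var A p m : (U_(enum_rank p) + m)%MM = mdeg_of_set A ->
  p \in A /\ m = mdeg_of_set (A :\ p).
Proof.
move=> E; have pA : p \in A.
  have /mnmP/(_ (enum_rank p)) := E.
  by rewrite mnmDE mnm1E eqxx mnmE enum_rankK; case: (p \in A).
by split=> //; apply: (@addmI _ U_(enum_rank p)%MM); rewrite E mdeg_of_setD1.
Qed.

Lemma prod_poset_var C : \prod_(p in C) poset_var k p = 'X_[mdeg_of_set C].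
Proof.
rewrite -(big_morph (fun m => 'X_[m]) (@mpolyXD #|P| k) (@mpolyX0 #|P| k)).
congr mpolyX; apply/mnmP => a; rewrite mnm_sumE mnmE.
rewrite (eq_bigr (fun p => (p == enum_val a) : nat)) => [|p _]; last first.
  by rewrite mnm1E -(inj_eq enum_val_inj) enum_rankK.
rewrite -big_mkcondr /= sum1_card; case: (boolP (enum_val a \in C)) => aC.
  rewrite (eq_card (B := pred1 (enum_val a))) ?card1 // => p.
  by rewrite unfold_in inE; case: eqP => [->|_]; rewrite ?aC ?andbF.
rewrite eq_card0 // => p.
by rewrite unfold_in inE; case: eqP => [->|_]; rewrite ?(negbTE aC) ?andbF.
Qed.

Lemma maximal_chain_flag_ideal C :
  is_maximal_chain C -> @flag_ideal k _ P 'X_[mdeg_of_set C].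
Proof.
move=> mC; exists (fun C' => (C' == C)%:R); rewrite (bigD1 C) //= eqxx mul1r.
rewrite [X in _ + X]big1 ?addr0 ?prod_poset_var // => C' /andP[_ /negbTE->].
by rewrite mul0r.
Qed.

Lemma flag_ideal_msupp f m : @flag_ideal k _ P f -> m \in msupp f ->
  exists C m', is_maximal_chain C /\ (mdeg_of_set C + m')%MM = m.
Proof.
case=> c -> /msupp_sum_le; case/flatten_mapP => C.
rewrite mem_filter => /andP[mC _].
rewrite prod_poset_var (perm_mem (msuppMX _ _)) => /mapP[m' _ ->].
by exists C, m'.
Qed.

End SquarefreeDegrees.

(** * Necessity: a nonzero strand vector forces the conditions *)

Section FlagStrand.

Variables (k : fieldType) (disp : Order.disp_t) (P : finPOrderType disp).
Variables (r : P -> nat) (s : nat) (F : free_sequence k #|P|).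
Hypothesis r_rank : is_rank_function r.
Hypothesis s_min : is_min_max_rank r s.
Hypothesis resF : minimal_free_resolution F (@flag_ideal k disp P).
Implicit Types (A : {set P}) (p q b c : P).

Lemma flag_ideal_mdeg_ge f m : @flag_ideal k disp P f -> m \in msupp f ->
  (s <= mdeg m)%N.
Proof.
move=> If /(flag_ideal_msupp If)[C [m' [mC <-]]]; rewrite mdegD mdeg_mdeg_of_set.
by apply: leq_trans (leq_addr _ _);
  apply: hits_ranks_card (maximal_chain_hits r_rank s_min mC).
Qed.

Lemma strand_xpartD1 j A (u : 'rV[k]_(frank F j.+1)) p :
  strand (mdeg_of_set A) u -> u *m xpart F j (enum_rank p) != 0 ->
  p \in A /\ strand (mdeg_of_set (A :\ p)) (u *m xpart F j (enum_rank p)).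
Proof.
move=> uA u0; split; last first.
  by move=> l /(strand_xpart resF uA)/mdeg_of_set_var[].
by have /rV0Pn[l /(strand_xpart resF uA)/mdeg_of_set_var[]] := u0.
Qed.

Lemma xpart_neq0_other j A (u : 'rV[k]_(frank F j.+1)) c :
  #|A| = (j.+1 + s)%N -> strand (mdeg_of_set A) u -> u != 0 ->
  exists2 b, b != c & u *m xpart F j (enum_rank b) != 0.
Proof.
move=> cardA uA u0.
case: (pickP [pred b | (b != c) && (u *m xpart F j (enum_rank b) != 0)]) => [b /andP[]|H].
  by exists b.
case/eqP: u0; apply: (xpart_eq0 resF flag_ideal_mdeg_ge (c := enum_rank c) uA).
  by rewrite mdeg_mdeg_of_set.
move=> a ac; have := H (enum_val a); rewrite /= enum_valK => /negbT.
rewrite negb_and !negbK -(inj_eq enum_rank_inj) enum_valK (negbTE ac) /=.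
by move/eqP.
Qed.

(* The case j = 0 is False because a set of size s with an element of every rank
   has no twins. *)
Definition part_neq0 j : 'rV[k]_(frank F j) -> P -> Prop :=
  match j with
  | 0 => fun _ _ => False
  | j'.+1 => fun u p => u *m xpart F j' (enum_rank p) != 0
  end.

(** By anticommutation, the b-part of the c-part of [u] is minus the c-part of its b-part. *)
Lemma part_swap j A (u : 'rV[k]_(frank F j.+1)) b c :
  #|A| = (j.+1 + s)%N -> strand (mdeg_of_set A) u -> b != c ->
  part_neq0 (u *m xpart F j (enum_rank c)) b -> u *m xpart F j (enum_rank b) != 0.
Proof.
case: j u => // j u cardA uA bc; apply: contra_neq => E.
rewrite (xpart_anticomm resF flag_ideal_mdeg_ge uA) ?mdeg_mdeg_of_set //.
  by rewrite E mul0mx oppr0.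
by rewrite (inj_eq enum_rank_inj) eq_sym.
Qed.

(** The second conclusion strengthens the induction: it turns each twin in A minus c into a further
    nonzero part of [u]. *)
Lemma strand_complete j A (u : 'rV[k]_(frank F j)) :
  #|A| = (j + s)%N -> strand (mdeg_of_set A) u -> u != 0 ->
  complete_ranked r s A /\ forall b b', twins r A b b' -> part_neq0 u b.
Proof.
elim: j A u => [|j IHj] A u cardA uA u0.
  have /rV0Pn[l ul] := u0.
  have [Il lm] := faug_monomial resF l.
  have [C [m' [mC E]]] := flag_ideal_msupp Il lm.
  rewrite (uA l ul) in E.
  (* The chain lies in A and has at least s = |A| elements. *)
  have CA : C = A.
    apply/eqP; rewrite eqEcard (mdeg_of_set_le E) cardA.
    exact: hits_ranks_card (maximal_chain_hits r_rank s_min mC).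
  subst C; have cA := maximal_chain_complete r_rank s_min mC cardA.
  split=> // b b' t; have [_ _ hits _] := cA.
  by have := hits_ranks_twins_card t hits; rewrite cardA ltnn.
have part c : u *m xpart F j (enum_rank c) != 0 ->
    [/\ c \in A, complete_ranked r s (A :\ c) &
        forall b b', twins r (A :\ c) b b' -> u *m xpart F j (enum_rank b) != 0].
  move=> uc; have [cA ucA] := strand_xpartD1 uA uc.
  have cardAc : #|A :\ c| = (j + s)%N by move: cardA; rewrite (cardsD1 c) cA; lia.
  have [compl tw] := IHj _ _ cardAc ucA uc.
  split; [exact: cA | exact: compl | move=> b b' t].
  apply: (part_swap cardA uA) (tw b b' t).
  by case: t; rewrite !inE => /andP[].
(* [p0] is an arbitrary starting element; excluding it yields c, and excluding c yields b. *)
have [[p0 _ _] _] := s_min.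
have [c _ uc] := xpart_neq0_other p0 cardA uA u0.
have [b bc ub] := xpart_neq0_other c cardA uA u0.
have [cA compl_c tw_c] := part c uc.
have [bA compl_b _] := part b ub.
have rank_c x : x \in A -> x != c -> (r x <= s)%N.
  by move=> xA xc; have [le_s _ _ _] := compl_c; apply: le_s; rewrite !inE xc.
split.
  have [E|rbc] := eqVneq (r b) (r c).
    by apply: complete_ranked_glue compl_b compl_c; split.
  (* b has a twin b' in A :\ b, also in A :\ c, so A :\ b' is complete too. *)
  have [_ _ hits_b _] := compl_b.
  have [b' t] := hits_ranks_twin r_rank hits_b bA (rank_c _ bA bc).
  have b'c : b' != c.
    by case: t => _ _ _ E; apply: contra_neq rbc => <-.
  have t' := twinsD1 t bc b'c.
  have [_ compl_b' _] := part b' (tw_c _ _ (twinsC t')).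
  exact: complete_ranked_glue t compl_b compl_b'.
move=> x x' t /=.
(* Apart from b and c themselves, the pair x, x' survives in A minus c, or, when x' = c, in A minus
   b. *)
have [->|xc] := eqVneq x c; first exact: uc.
have [->|xb] := eqVneq x b; first exact: ub.
have [E|x'c] := eqVneq x' c; last first.
  exact: tw_c (twinsD1 t xc x'c).
subst x'; have [_ _ tw_b] := part b ub; apply: tw_b (twinsD1 t xb _).
by rewrite eq_sym.
Qed.

End FlagStrand.

(** * Antisymmetric double sums and Koszul signs *)

Lemma sum_antisym (V : zmodType) (n : nat) (g : 'I_n -> 'I_n -> V) :
  (forall a, g a a = 0) -> (forall a b, a != b -> g a b = - g b a) ->
  \sum_a \sum_b g a b = 0.
Proof.
move=> g0 gN.
(* The terms below the diagonal cancel those above it. The diagonal has its own hypothesis, as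
   antisymmetry says nothing about it in characteristic 2. *)
rewrite (eq_bigr (fun a : 'I_n => \sum_(b < n | (b < a)%N) g a b
                         + \sum_(b < n | (a < b)%N) g a b)); last first.
  move=> a _; rewrite (bigID (fun b : 'I_n => (b < a)%N)) /=; congr (_ + _).
  under eq_bigl => b do rewrite -leqNgt.
  by rewrite (bigD1 a) //= g0 add0r; apply: eq_bigl => b; rewrite [RHS]ltn_neqAle andbC eq_sym.
rewrite big_split /= [X in _ + X](exchange_big_dep predT) //= -big_split big1 //= => a _.
rewrite -big_split big1 //= => b ba; rewrite gN ?addNr //.
by apply: contraTneq ba => ->; rewrite ltnn.
Qed.

Section KoszulSigns.

Variables (disp : Order.disp_t) (P : finPOrderType disp) (r : P -> nat).
Implicit Types (A : {set P}) (p q : P).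

(* Comparing ranks first makes two twins consecutive when they are the only ones,
   so that they get opposite Koszul signs. *)
Definition before p q : bool :=
  (r p < r q)%N || (r p == r q) && (enum_rank p < enum_rank q)%N.

Lemma before_irr p : before p p = false.
Proof. by rewrite /before !ltnn andbF. Qed.

Lemma before_total p q : p != q -> before q p = ~~ before p q.
Proof.
rewrite -(inj_eq enum_rank_inj) -(inj_eq val_inj) /= /before.
by case: (ltngtP (r p)) => //=; case: ltngtP.
Qed.

Definition koszul_sign (R : pzRingType) A p : R :=
  (-1) ^+ #|[set q in A | before q p]|.

Lemma koszul_signD1 (R : pzRingType) A p q : q \in A ->
  koszul_sign R A p = (if before q p then -1 else 1) * koszul_sign R (A :\ q) p.
Proof.
move=> qA; rewrite /koszul_sign (cardsD1 q) inE qA /= exprD.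
congr (_ * (-1) ^+ _); first by case: before.
by apply: eq_card => x; rewrite !inE andbA.
Qed.

(** Exactly one of p, q comes before the other, so exactly one of the two signs changes when the
    other element is removed. *)
Lemma koszul_sign_anticomm (R : comPzRingType) A p q : p \in A -> q \in A -> p != q ->
  koszul_sign R A p * koszul_sign R (A :\ p) q
  = - (koszul_sign R A q * koszul_sign R (A :\ q) p).
Proof.
move=> pA qA pq; rewrite (koszul_signD1 _ p qA) (koszul_signD1 _ q pA).
rewrite (before_total pq); case: before => /=; rewrite ?mulN1r ?mul1r ?mulNr ?opprK mulrC //.
Qed.

End KoszulSigns.

(** * Sufficiency: nonzero strand vectors by induction on homological degree *)

Section FlagConverse.

Variables (k : fieldType) (disp : Order.disp_t) (P : finPOrderType disp).
Variables (r : P -> nat) (s : nat) (F : free_sequence k #|P|).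
Hypothesis r_rank : is_rank_function r.
Hypothesis s_min : is_min_max_rank r s.
Hypothesis resF : minimal_free_resolution F (@flag_ideal k disp P).
Implicit Types (A : {set P}) (p q b c : P).

(** Decidability allows the vectors U A to be chosen by cases on this condition, with 0 as
    default. *)
Definition complete_rankedb A : bool :=
  [&& [forall p in A, (r p <= s)%N],
      [forall p in A, (r p == s) ==> (p \in max_elements P)],
      [forall i : 'I_s, [exists p in A, r p == i.+1]]
    & [forall p in A, forall q in A, (r q == (r p).+1) ==> (p < q)%O]].

Lemma complete_rankedP A : reflect (complete_ranked r s A) (complete_rankedb A).
Proof.
apply: (iffP and4P) => -[le_s maxs hits lts]; split.
- by move=> p pA; apply: (forall_inP le_s).
- by move=> p pA /eqP; apply/implyP/(forall_inP maxs).
- move=> i /andP[i0 is']; have lt_i : (i.-1 < s)%N by lia.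
  have /forallP/(_ (Ordinal lt_i))/exists_inP[p pA /eqP E] := hits.
  by exists p; rewrite // E /= prednK.
- move=> p q pA qA /eqP; apply/implyP; exact: (forall_inP (forall_inP lts p pA)).
- exact/forall_inP.
- by apply/forall_inP => p pA; apply/implyP => /eqP; apply: maxs.
- apply/forallP => i; have [|p pA E] := hits i.+1; first by rewrite ltn_ord.
  by apply/exists_inP; exists p; rewrite ?E.
- apply/forall_inP => p pA; apply/forall_inP => q qA; apply/implyP => /eqP.
  exact: lts.
Qed.

Definition has_twin A p : bool :=
  [exists q, [&& p \in A, q \in A, p != q & r p == r q]].

Lemma has_twinP A p : reflect (exists q, twins r A p q) (has_twin A p).
Proof.
apply: (iffP existsP) => -[q].
  by case/and4P=> ? ? ? /eqP; exists q; split.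
by case=> pA qA pq E; exists q; rewrite pA qA pq E eqxx.
Qed.

(** If p and q have different ranks, removing one leaves the twins of the other; if they have the
    same rank, the twin q' of q is a third element of that rank and serves both. *)
Lemma has_twin_swap A p q : has_twin A p && has_twin (A :\ p) q ->
  has_twin A q && has_twin (A :\ q) p.
Proof.
case/andP=> /has_twinP[p' tp] /has_twinP[q' tq].
have qp : q != p by case: tq; rewrite !inE => /andP[].
have q'p : q' != p by case: tq => _; rewrite !inE => /andP[].
have tq' := twins_sub tq; apply/andP; split; apply/has_twinP; first by exists q'.
have [pA _ _ _] := tp; have [_ q'A qq' Eq] := tq'.
have [E|ne] := eqVneq (r p) (r q).
  exists q'; apply: twinsD1; [split=> // | by rewrite eq_sym | by rewrite eq_sym].
    by rewrite eq_sym.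
  by rewrite E.
exists p'; apply: (twinsD1 tp); first by rewrite eq_sym.
by case: tp => _ _ _ E; apply: contra_neq ne => <-.
Qed.

(** The prescribed x_p-part of the vector to be built for A; it is 0 when removing p would empty a
    rank. *)
Definition faces j (U : {set P} -> 'rV[k]_(frank F j)) A p : 'rV[k]_(frank F j) :=
  if has_twin A p then koszul_sign r k A p *: U (A :\ p) else 0.

Lemma faces_swap j (U : {set P} -> 'rV[k]_(frank F j)) A p q : p != q ->
  (if has_twin A p then koszul_sign r k A p *: faces U (A :\ p) q else 0)
  = - (if has_twin A q then koszul_sign r k A q *: faces U (A :\ q) p else 0).
Proof.
move=> pq; rewrite /faces.
have E : has_twin A p && has_twin (A :\ p) q = has_twin A q && has_twin (A :\ q) p.
  by apply/idP/idP; apply: has_twin_swap.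
have nested (x y : bool) (c d : k) (v : 'rV[k]_(frank F j)) :
  (if x then c *: (if y then d *: v else 0) else 0)
  = (if x && y then (c * d) *: v else 0).
  by case: x => //; case: y; rewrite ?scaler0 ?scalerA.
rewrite !nested -E; case: ifP => [xy|_]; last by rewrite oppr0.
have qA : q \in A by move: xy; rewrite E => /andP[/has_twinP[? []]].
have pA : p \in A by move: xy => /andP[/has_twinP[? []]].
rewrite -scaleNr (koszul_sign_anticomm _ _ pA qA pq); congr (_ *: U _).
by apply/setP => x; rewrite !inE andbCA.
Qed.

Lemma strandZ j A (c : k) (u : 'rV[k]_(frank F j)) :
  strand (mdeg_of_set A) u -> strand (mdeg_of_set A) (c *: u).
Proof. by move=> uA l; rewrite mxE mulf_eq0 negb_or => /andP[_ /uA]. Qed.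

(** The set A minus p has s elements and meets s ranks, so it has no twins; every twin pair of A
    therefore involves p, and its other member must be q. *)
Lemma twin_pair A p q : complete_ranked r s A -> #|A| = s.+1 -> twins r A p q ->
  forall c, has_twin A c -> c = p \/ c = q.
Proof.
move=> cA cardA t c /has_twinP[c' tc].
have [->|cp] := eqVneq c p; first by left.
have [->|cq] := eqVneq c q; first by right.
have [_ _ hits _] := cA; exfalso.
have no_twins z z' : ~ twins r (A :\ p) z z'.
  move=> t'; have := hits_ranks_twins_card t' (hits_ranksD1 t hits).
  by move: cardA; rewrite (cardsD1 p); case: t => -> _ _ _; lia.
have [c'p|c'p] := eqVneq c' p; last exact: no_twins (twinsD1 tc cp c'p).
subst c'; have [pA qA pq E] := t; have [cA' _ _ E'] := tc.
by apply: (no_twins c q); split; rewrite ?inE ?cp ?cA' // 1?eq_sym ?pq // E' E.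
Qed.

(** No third element shares their rank, so the elements before q are those before p together with p
    itself, up to exchanging p and q. *)
Lemma koszul_sign_twin_pair A p q : complete_ranked r s A -> #|A| = s.+1 ->
  twins r A p q -> koszul_sign r k A q = - koszul_sign r k A p.
Proof.
move=> cA cardA t.
wlog pq : p q t / before r p q.
  move=> H; have [pq|] := boolP (before r p q); first exact: H.
  have [_ _ ne _] := t; rewrite -before_total // => qp.
  by rewrite (H _ _ (twinsC t) qp) opprK.
have [pA qA ne E] := t.
rewrite (koszul_signD1 _ _ _ pA) pq mulN1r; congr (- _).
congr ((-1) ^+ _); apply: eq_card => x; rewrite !inE.
have [->|xp] /= := eqVneq x p; first by rewrite before_irr andbF.
case xA: (x \in A) => //=; rewrite /before E.
have [Ex|//] := eqVneq (r x) (r q).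
have [xq|xq] := eqVneq x q.
  subst x; rewrite !ltnn /=; move: pq; rewrite /before E ltnn eqxx /= => pq.
  by rewrite ltnNge (ltnW pq).
have := @twin_pair A p q cA cardA t x; case.
- by apply/has_twinP; exists q; split.
- by move/eqP; rewrite (negbTE xp).
- by move/eqP; rewrite (negbTE xq).
Qed.

(** The second clause carries the cycle condition that permits the lift to homological degree j +
    1. *)
Definition strand_family j (U : {set P} -> 'rV[k]_(frank F j)) : Prop :=
  (forall A, complete_ranked r s A -> #|A| = (j + s)%N ->
     strand (mdeg_of_set A) (U A) /\ U A != 0) /\
  (forall A, complete_ranked r s A -> #|A| = (j.+1 + s)%N ->
     bdry_zero (\sum_a 'X_a *: const_row (faces U A (enum_val a)))).

Lemma strand_family_base : exists U, @strand_family 0 U.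
Proof.
have ge := @flag_ideal_mdeg_ge k _ _ _ _ r_rank s_min.
have /fin_all_exists[U UP] A : exists u : 'rV[k]_(frank F 0),
    is_maximal_chain A && (#|A| == s) ->
    strand (mdeg_of_set A) u /\ const_row u *m faug F = ('X_[mdeg_of_set A])%:M.
  have [/andP[mA /eqP cardA]|_] := boolP (is_maximal_chain A && (#|A| == s)); last by exists 0.
  have [||u uA uE] := generator_lift resF ge (B := mdeg_of_set A).
  - by rewrite mdeg_mdeg_of_set.
  - exact: maximal_chain_flag_ideal.
  by exists u.
exists U; have UP' A : complete_ranked r s A -> #|A| = s ->
    strand (mdeg_of_set A) (U A) /\ const_row (U A) *m faug F = ('X_[mdeg_of_set A])%:M.
  move=> cA cardA; apply: UP; rewrite cardA eqxx andbT.
  exact: complete_ranked_maximal_chain cA cardA.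
split=> A cA cardA.
  have [uA uE] := UP' A cA cardA; split=> //; apply/eqP => E.
  have /matrixP/(_ 0 0)/(congr1 (mcoeff (mdeg_of_set A)))/eqP := uE.
  rewrite E /const_row map_mx0 mul0mx !mxE eqxx mulr1n mcoeffX eqxx mcoeff0.
  by rewrite eq_sym oner_eq0.
rewrite /bdry_zero mulmx_suml.
(* Each face is sent to its sign times x^A, so the cycle condition reduces to the opposite signs of
   the only two twins. *)
have faceE a : ('X_a *: const_row (faces U A (enum_val a))) *m faug F =
   (if has_twin A (enum_val a) then koszul_sign r k A (enum_val a) else 0)%:MP
     *: ('X_[mdeg_of_set A])%:M.
  rewrite /faces; case: ifP => [/has_twinP[q t]|_]; last first.
    by rewrite /const_row map_mx0 scaler0 mul0mx mpolyC0 scale0r.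
  have cA' := complete_rankedD1 t cA.
  have [aA _ _ _] := t.
  have cardA' : #|A :\ enum_val a| = s.
    by move: cardA; rewrite (cardsD1 (enum_val a)) aA; lia.
  have [_ uE] := UP' _ cA' cardA'.
  rewrite /const_row map_mxZ -!scalemxAl -/(const_row _) uE.
  rewrite -(mdeg_of_setD1 aA) enum_valK mpolyXD !scale_scalar_mx.
  by congr (_%:M); rewrite mulrCA.
rewrite (eq_bigr _ (fun a _ => faceE a)) -scaler_suml -raddf_sum /=.
have [le_s _ _ _] := cA.
have [|p [q t]] := twins_exist r_rank le_s; first by rewrite cardA.
rewrite (reindex _ (onW_bij _ (@enum_rank_bij P))) /=.
under eq_bigr => x _ do rewrite enum_rankK.
have twp : has_twin A p by apply/has_twinP; exists q.
have twq : has_twin A q by apply/has_twinP; exists p; apply: twinsC.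
have qp : q != p by rewrite eq_sym; case: t.
rewrite (bigD1 p) //= (bigD1 q) //= twp twq (koszul_sign_twin_pair cA cardA t).
rewrite big1 ?addr0 ?subrr ?mpolyC0 ?scale0r // => x /andP[xp xq].
case: ifP => // /(twin_pair cA cardA t)[] E.
- by rewrite E eqxx in xp.
- by rewrite E eqxx in xq.
Qed.

Lemma strand_family_step j :
  (exists U, @strand_family j U) -> exists U, @strand_family j.+1 U.
Proof.
have ge := @flag_ideal_mdeg_ge k _ _ _ _ r_rank s_min.
case=> U [UP Uker].
have /fin_all_exists[U' U'P] A : exists u : 'rV[k]_(frank F j.+1),
    complete_rankedb A && (#|A| == j.+1 + s)%N ->
    strand (mdeg_of_set A) u /\
    forall a, u *m xpart F j a = faces U A (enum_val a).
  case: (boolP (_ && _)) => [/andP[/complete_rankedP cA /eqP cardA]|_]; last by exists 0.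
  have [||u uA uE] := xpart_lift resF (B := mdeg_of_set A)
    (w := fun a => faces U A (enum_val a)); last by exists u.
    move=> a l; rewrite /faces; case: ifP => [/has_twinP[q t]|_]; last by rewrite mxE eqxx.
    have [aA _ _ _] := t; have cA' := complete_rankedD1 t cA.
    rewrite mxE mulf_eq0 negb_or => /andP[_].
    have [|uA _] := UP _ cA'; first by move: cardA; rewrite (cardsD1 (enum_val a)) aA; lia.
    by move/uA->; rewrite -{1}(enum_valK a) mdeg_of_setD1.
  exact: Uker.
exists U'; have U'P' A : complete_ranked r s A -> #|A| = (j.+1 + s)%N ->
    strand (mdeg_of_set A) (U' A) /\
    forall a, U' A *m xpart F j a = faces U A (enum_val a).
  by move=> /complete_rankedP cA cardA; apply: U'P; rewrite cA cardA eqxx.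
split=> A cA cardA.
  have [uA uE] := U'P' A cA cardA; split=> //; apply/eqP => E.
  have [le_s _ _ _] := cA.
  (* A has more than s elements, hence twins, and the part of [U' A] at a twin p is a sign times the
     nonzero vector [U (A :\ p)]. *)
  have [|p [q t]] := twins_exist r_rank le_s; first by rewrite cardA; lia.
  have := uE (enum_rank p); rewrite E mul0mx enum_rankK /faces.
  have -> : has_twin A p by apply/has_twinP; exists q.
  move/esym/eqP; rewrite scaler_eq0 /koszul_sign signr_eq0 /=.
  have cA' := complete_rankedD1 t cA; have [pA _ _ _] := t.
  have [|_ /negbTE-> //] := UP _ cA'.
  by move: cardA; rewrite (cardsD1 p) pA; lia.
rewrite /bdry_zero mulmx_suml.
(* The boundary becomes a double sum over ordered pairs of removed elements, antisymmetric by
   [faces_swap]; its diagonal vanishes since an element cannot be removed twice. *)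
pose g (a b : 'I_#|P|) := 'X_a *: ('X_b *: const_row
  (if has_twin A (enum_val a)
   then koszul_sign r k A (enum_val a) *: faces U (A :\ enum_val a) (enum_val b) else 0)).
rewrite (eq_bigr (fun a => \sum_b g a b)) => [|a _].
  apply: sum_antisym => [a|a b' ab'].
    rewrite /g /faces; case: ifP => _; last by rewrite /const_row map_mx0 !scaler0.
    case: ifP => [/has_twinP[? []]|]; first by rewrite !inE eqxx.
    by rewrite scaler0 /const_row map_mx0 !scaler0.
  rewrite /g faces_swap ?(inj_eq enum_val_inj) //.
  by rewrite /const_row map_mxN !scalerN !scalerA mulrC.
(* It remains to expand the boundary of each face, whose own parts are the faces of A minus a. *)
rewrite -scalemxAl /g -scaler_sumr; congr (_ *: _); rewrite {1}/faces.
case: ifP => [/has_twinP[q t]|_]; last first.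
  rewrite /const_row map_mx0 mul0mx big1 // => b' _.
  by rewrite map_mx0 scaler0.
have cA' := complete_rankedD1 t cA; have [aA _ _ _] := t.
have cardA' : #|A :\ enum_val a| = (j.+1 + s)%N.
  by move: cardA; rewrite (cardsD1 (enum_val a)) aA; lia.
have [uA uE] := U'P' _ cA' cardA'.
rewrite (strand_bdry resF ge (@strandZ _ _ _ _ uA)) ?mdeg_mdeg_of_set //.
by apply: eq_bigr => b _; rewrite -scalemxAl uE.
Qed.

Lemma complete_strand j A : complete_ranked r s A -> #|A| = (j + s)%N ->
  exists2 u : 'rV[k]_(frank F j), strand (mdeg_of_set A) u & u != 0.
Proof.
move=> cA cardA; suff [U [/(_ A cA cardA)[uA u0] _]] : exists U, @strand_family j U.
  by exists (U A).
elim: j {cardA} => [|j]; [exact: strand_family_base | exact: strand_family_step].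
Qed.

End FlagConverse.

(* From Betti numbers to strand vectors, and the equivalence *)
Local Close Scope ring_scope.

(** A basis element of degree A gives a unit row, and a nonzero coordinate of a strand vector gives
    back such a basis element. *)
Lemma appears_in_strandP (k : fieldType) (disp : Order.disp_t)
    (P : finPOrderType disp) (s : nat) (F : free_sequence k #|P|) (A : {set P}) :
  appears_in_strand F s A <->
  exists j, #|A| = (j + s)%N /\
    exists2 u : 'rV[k]_(frank F j), strand (mdeg_of_set A) u & u != 0%R.
Proof.
split=> [[j /eqP bA cardA]|[j [cardA [u uA u0]]]]; exists j => //.
  move: bA; rewrite -lt0n => /card_gt0P[i]; rewrite inE => /eqP iA.
  split=> //; exists (delta_mx 0 i)%R; last exact: delta_row_neq0.
  by move=> l; rewrite mxE eqxx /=; case: (l =P i) => [->|_]; rewrite // eqxx.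
have /rV0Pn[l /uA lA] := u0; apply/eqP; rewrite -lt0n; apply/card_gt0P.
by exists l; rewrite inE lA.
Qed.

Lemma complete_rankedE (disp : Order.disp_t) (P : finPOrderType disp)
    (r : P -> nat) (s : nat) (A : {set P}) :
  is_rank_function r -> is_min_max_rank r s ->
  complete_ranked r s A <->
  [/\ (forall p : P, p \in A -> r p <= s) /\
        rank_part r A s \subset max_elements P,
      forall i : nat, 1 <= i <= s -> rank_part r A i != set0
    & forall i : nat, 1 <= i <= s - 1 ->
        forall p q : P, p \in B_part r A i -> q \in rank_part r A i.+1 ->
          (p < q)%O].
Proof.
move=> r_rank s_min; split=> [[le_s maxs hits lts]|[[le_s maxs] hits lts]]; split.
- split=> //; apply/subsetP => p; rewrite in_set => /andP[pA /eqP]; exact: maxs.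
- by move=> i /hits[p pA E]; apply/set0Pn; exists p; rewrite in_set pA E eqxx.
- move=> i _ p q pB; rewrite in_set => /andP[qA /eqP Eq].
  have : p \in rank_part r A i.
    by move: pB; rewrite /B_part; case: ifP => // _; rewrite in_setD => /andP[].
  by rewrite in_set => /andP[pA /eqP Ep]; apply: lts; rewrite // Eq Ep.
- exact: le_s.
- by move=> p pA E; apply: (subsetP maxs); rewrite in_set pA E eqxx.
- move=> i /hits/set0Pn[p]; rewrite in_set => /andP[pA /eqP E].
  by exists p.
move=> p q pA qA E; have qs := le_s q qA; have p0 := rank_gt0 r_rank p.
apply: (lts (r p)); last by rewrite in_set qA E eqxx.
  by lia.
rewrite /B_part; case: ifP => _; first by rewrite in_set pA eqxx.
rewrite in_setD [p \in rank_part _ _ _]in_set pA eqxx !andbT.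
apply/negP => pmax; have := max_rank_ge s_min pmax; lia.
Qed.

Theorem proposition5p8 (k : fieldType) (disp : Order.disp_t)
    (P : finPOrderType disp) (r : P -> nat) (s : nat)
    (F : free_sequence k #|P|) (A : {set P}) :
  is_rank_function r ->
  is_min_max_rank r s ->
  minimal_free_resolution F (@flag_ideal k disp P) ->
  appears_in_strand F s A <->
  [/\ (forall p : P, p \in A -> r p <= s) /\
        rank_part r A s \subset max_elements P,
      forall i : nat, 1 <= i <= s -> rank_part r A i != set0
    & forall i : nat, 1 <= i <= s - 1 ->
        forall p q : P, p \in B_part r A i -> q \in rank_part r A i.+1 ->
          (p < q)%O].
Proof.
move=> r_rank s_min resF.
apply: iff_trans _ (complete_rankedE A r_rank s_min).
apply: iff_trans (appears_in_strandP s F A) _; split.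
  by move=> [j [cardA [u uA u0]]]; have [] := strand_complete r_rank s_min resF cardA uA u0.
move=> cA; have [_ _ hits _] := cA; have le_sA := hits_ranks_card hits.
(* The truncated subtraction is exact, since meeting s ranks takes at least s elements. *)
exists (#|A| - s); rewrite subnK //; split=> //.
by apply: complete_strand r_rank s_min resF _ _ cA _; rewrite subnK.
Qed.
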